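(* Let $(X,\triangleright)$ be a rack, let $*\in X$ be a fixed element, and let $\mathbb Z\{X\}$ be the rack algebra of $X$. For $n\ge 0$ let $C_n(X)=\mathbb Z\{X\}X^n$ be the free left $\mathbb Z\{X\}$-module with basis $X^n$ (where $X^0=\{*\}$ is a singleton). Let $\partial=\partial_n:C_{n+1}(X)\to C_n(X)$ be the $\mathbb Z\{X\}$-linear map defined on the basis, for $n\ge1$, by $$\begin{aligned}\partial(x_1,\dots,x_{n+1})=&\sum_{i=1}^n(-1)^i\,\eta_{[x_1\cdots x_i],[x_1\cdots\widehat{x_i}\cdots x_{n+1}]}\,(x_1,\dots,\widehat{x_i},\dots,x_{n+1})\\&-\sum_{i=1}^n(-1)^i(x_1,\dots,x_{i-1},x_i\triangleright x_{i+1},\dots,x_i\triangleright x_{n+1})\\&-(-1)^{n+1}\,\tau_{[x_1\cdots x_n],[x_1\cdots x_{n-1}x_{n+1}]}\,(x_1,\dots,x_n),\end{aligned}$$ and for $n=0$ by $\partial(x)=-\tau_{*,*^{-1}\triangleright x}\,*$. Then $(C_\bullet(X),\partial)$ is a complex, i.e. $\partial_{n-1}\partial_n=0$ for all $n\ge 1$.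
   Context: A rack is a pair $(X,\triangleright)$ where $X$ is a non-empty set and $\triangleright:X\times X\to X$ is such that each $\phi_i(j)=i\triangleright j$ is a bijection of $X$ and $i\triangleright(j\triangleright k)=(i\triangleright j)\triangleright(i\triangleright k)$ for all $i,j,k$. Write $i^{-1}\triangleright j=\phi_i^{-1}(j)$. For $(x_1,\dots,x_n)\in X^n$ put $[x_1\cdots x_n]=x_1\triangleright(x_2\triangleright(\cdots(x_{n-1}\triangleright x_n)\cdots))$ (so $[x_1]=x_1$). A hat denotes omission. The rack algebra $\mathbb Z\{X\}$ is the (associative, unital) $\mathbb Z$-algebra presented by generators $\eta_{ij}^{\pm1}$ and $\tau_{ij}$, $i,j\in X$, with relations $\eta_{ij}\eta_{ij}^{-1}=\eta_{ij}^{-1}\eta_{ij}=1$ and, for all $i,j,k\in X$, $\eta_{i,j\triangleright k}\eta_{j,k}=\eta_{i\triangleright j,i\triangleright k}\eta_{i,k}$, $\tau_{i,j\triangleright k}=\eta_{i\triangleright j,i\triangleright k}\tau_{i,k}+\tau_{i\triangleright j,i\triangleright k}\tau_{i,j}$, $\eta_{i,j\triangleright k}\tau_{j,k}=\tau_{i\triangleright j,i\triangleright k}\eta_{i,j}$. *)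

(* Defs.v *)
From HB Require Import structures.
From mathcomp Require Import all_boot all_algebra.
From mathcomp Require Import boolp.
From mathcomp.multinomials Require Import freeg.

Set Implicit Arguments.
Unset Strict Implicit.
Unset Printing Implicit Defensive.

Import GRing.Theory.
Local Open Scope ring_scope.
Local Open Scope quotient_scope.

HB.mixin Record isRack X of Choice X := {
  rack_op : X -> X -> X;
  rack_nonempty : inhabited X;
  rack_op_bij : forall i, bijective (rack_op i);
  rack_opD : forall i j k,
    rack_op i (rack_op j k) = rack_op (rack_op i j) (rack_op i k)
}.

#[short(type="rackType")]
HB.structure Definition Rack := { X of Choice X & isRack X }.

Notation "i ▷ j" := (rack_op i j) (at level 40, j at next level).

Section RackTheory.
Variable X : rackType.
Implicit Types (i j : X) (s : seq X).

Lemma rack_op_surj i j : exists k, i ▷ k == j.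
Proof. by have [g _ gK] := rack_op_bij i; exists (g j); rewrite gK. Qed.

(* i^-1 ▷ j *)
Definition rack_inv i j : X := xchoose (rack_op_surj i j).

Lemma rack_invK i : cancel (rack_inv i) (rack_op i).
Proof. by move=> j; apply/eqP; exact: xchooseP (rack_op_surj i j). Qed.

Lemma rack_opK i : cancel (rack_op i) (rack_inv i).
Proof. by move=> j; apply: (bij_inj (rack_op_bij i)); rewrite rack_invK. Qed.

(* [x_1 ... x_n] = x_1 ▷ (x_2 ▷ ( ... ▷ x_n)); the bracket of the empty
   sequence is the irrelevant default value d *)
Fixpoint bracket (d : X) s : X :=
  match s with
  | [::] => d
  | [:: x] => x
  | x :: s' => x ▷ bracket d s'
  end.

End RackTheory.

Inductive rterm (G : Type) : Type :=
| RGen of G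
| RZero
| ROne
| ROpp of rterm G
| RAdd of rterm G & rterm G
| RMul of rterm G & rterm G.

Arguments RZero {G}.
Arguments ROne {G}.

(* the least congruence containing the relations r and the ring axioms *)
Inductive rcong (G : Type) (r : rterm G -> rterm G -> Prop) :
  rterm G -> rterm G -> Prop :=
| rcong_rel a b : r a b -> rcong r a b
| rcong_refl a : rcong r a a
| rcong_sym a b : rcong r a b -> rcong r b a
| rcong_trans a b c : rcong r a b -> rcong r b c -> rcong r a c
| rcong_opp a a' : rcong r a a' -> rcong r (ROpp a) (ROpp a')
| rcong_add a a' b b' :
    rcong r a a' -> rcong r b b' -> rcong r (RAdd a b) (RAdd a' b')
| rcong_mul a a' b b' :
    rcong r a a' -> rcong r b b' -> rcong r (RMul a b) (RMul a' b')
| rcong_addA a b c : rcong r (RAdd a (RAdd b c)) (RAdd (RAdd a b) c)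
| rcong_addC a b : rcong r (RAdd a b) (RAdd b a)
| rcong_add0 a : rcong r (RAdd RZero a) a
| rcong_addN a : rcong r (RAdd (ROpp a) a) RZero
| rcong_mulA a b c : rcong r (RMul a (RMul b c)) (RMul (RMul a b) c)
| rcong_mul1l a : rcong r (RMul ROne a) a
| rcong_mul1r a : rcong r (RMul a ROne) a
| rcong_mulDl a b c :
    rcong r (RMul (RAdd a b) c) (RAdd (RMul a c) (RMul b c))
| rcong_mulDr a b c :
    rcong r (RMul a (RAdd b c)) (RAdd (RMul a b) (RMul a c)).

HB.instance Definition _ (G : Type) := gen_eqMixin (rterm G).
HB.instance Definition _ (G : Type) := gen_choiceMixin (rterm G).

Section PresentedRing.
Variables (G : Type) (r : rterm G -> rterm G -> Prop).

Definition rcongb : rel (rterm G) := fun a b => `[< rcong r a b >].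

Fact rcongb_refl : reflexive rcongb.
Proof. by move=> a; apply/asboolP; apply: rcong_refl. Qed.

Fact rcongb_sym : symmetric rcongb.
Proof.
by move=> a b; apply/asboolP/asboolP => h; apply: rcong_sym.
Qed.

Fact rcongb_trans : transitive rcongb.
Proof.
move=> b a c /asboolP hab /asboolP hbc.
by apply/asboolP; apply: rcong_trans hab hbc.
Qed.

Canonical rcongb_equiv :=
  EquivRel rcongb rcongb_refl rcongb_sym rcongb_trans.

Definition presented_ring := {eq_quot rcongb}.

HB.instance Definition _ := Choice.on presented_ring.
HB.instance Definition _ := Quotient.on presented_ring.
HB.instance Definition _ : EqQuotient _ rcongb presented_ring :=
  EqQuotient.on presented_ring.

Definition prcls (a : rterm G) : presented_ring := \pi_presented_ring a.
Definition prgen (g : G) : presented_ring := prcls (RGen g).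

Lemma prclsP a b : prcls a = prcls b <-> rcong r a b.
Proof.
split=> [eq_ab|ab]; last by apply/eqmodP/asboolP.
by apply/asboolP; apply/(@eqmodP _ rcongb_equiv).
Qed.

Lemma prcls_surj (P : presented_ring -> Prop) :
  (forall a, P (prcls a)) -> forall x, P x.
Proof. by move=> h x; rewrite -[x]reprK; apply: h. Qed.

Lemma repr_prcls a : rcong r (repr (prcls a)) a.
Proof. by apply/prclsP; rewrite /prcls reprK. Qed.

Definition pr_opp (x : presented_ring) := prcls (ROpp (repr x)).
Definition pr_add (x y : presented_ring) := prcls (RAdd (repr x) (repr y)).
Definition pr_mul (x y : presented_ring) := prcls (RMul (repr x) (repr y)).

Fact pr_oppE a : pr_opp (prcls a) = prcls (ROpp a).
Proof. by apply/prclsP/rcong_opp/repr_prcls. Qed.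
Fact pr_addE a b : pr_add (prcls a) (prcls b) = prcls (RAdd a b).
Proof. by apply/prclsP/rcong_add; apply: repr_prcls. Qed.
Fact pr_mulE a b : pr_mul (prcls a) (prcls b) = prcls (RMul a b).
Proof. by apply/prclsP/rcong_mul; apply: repr_prcls. Qed.

Fact pr_addA : associative pr_add.
Proof.
elim/prcls_surj=> a; elim/prcls_surj=> b; elim/prcls_surj=> c.
by rewrite !pr_addE; apply/prclsP/rcong_addA.
Qed.
Fact pr_addC : commutative pr_add.
Proof.
elim/prcls_surj=> a; elim/prcls_surj=> b.
by rewrite !pr_addE; apply/prclsP/rcong_addC.
Qed.
Fact pr_add0 : left_id (prcls RZero) pr_add.
Proof. by elim/prcls_surj=> a; rewrite pr_addE; apply/prclsP/rcong_add0. Qed.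
Fact pr_addN : left_inverse (prcls RZero) pr_opp pr_add.
Proof.
by elim/prcls_surj=> a; rewrite pr_oppE pr_addE; apply/prclsP/rcong_addN.
Qed.

HB.instance Definition _ := GRing.isZmodule.Build presented_ring
  pr_addA pr_addC pr_add0 pr_addN.

Fact pr_mulA : associative pr_mul.
Proof.
elim/prcls_surj=> a; elim/prcls_surj=> b; elim/prcls_surj=> c.
by rewrite !pr_mulE; apply/prclsP/rcong_mulA.
Qed.
Fact pr_mul1l : left_id (prcls ROne) pr_mul.
Proof. by elim/prcls_surj=> a; rewrite pr_mulE; apply/prclsP/rcong_mul1l. Qed.
Fact pr_mul1r : right_id (prcls ROne) pr_mul.
Proof. by elim/prcls_surj=> a; rewrite pr_mulE; apply/prclsP/rcong_mul1r. Qed.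
Fact pr_mulDl : left_distributive pr_mul pr_add.
Proof.
elim/prcls_surj=> a; elim/prcls_surj=> b; elim/prcls_surj=> c.
by rewrite !(pr_mulE, pr_addE); apply/prclsP/rcong_mulDl.
Qed.
Fact pr_mulDr : right_distributive pr_mul pr_add.
Proof.
elim/prcls_surj=> a; elim/prcls_surj=> b; elim/prcls_surj=> c.
by rewrite !(pr_mulE, pr_addE); apply/prclsP/rcong_mulDr.
Qed.

HB.instance Definition _ := GRing.Zmodule_isPzRing.Build presented_ring
  pr_mulA pr_mul1l pr_mul1r pr_mulDl pr_mulDr.

Lemma prclsN a : prcls (ROpp a) = - prcls a. Proof. by rewrite -pr_oppE. Qed.
Lemma prclsD a b : prcls (RAdd a b) = prcls a + prcls b.
Proof. by rewrite -pr_addE. Qed.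
Lemma prclsM a b : prcls (RMul a b) = prcls a * prcls b.
Proof. by rewrite -pr_mulE. Qed.
Lemma prcls0 : prcls RZero = 0. Proof. by []. Qed.
Lemma prcls1 : prcls ROne = 1. Proof. by []. Qed.

Section UniversalProperty.
Variables (A : pzRingType) (f : G -> A).

Fixpoint reval (a : rterm G) : A :=
  match a with
  | RGen g => f g
  | RZero => 0
  | ROne => 1
  | ROpp a => - reval a
  | RAdd a b => reval a + reval b
  | RMul a b => reval a * reval b
  end.

Hypothesis f_rel : forall a b, r a b -> reval a = reval b.

Lemma reval_cong a b : rcong r a b -> reval a = reval b.
Proof.
elim=> //=.
- by move=> ? ? ? _ -> _ ->.
- by move=> ? ? _ ->.
- by move=> ? ? ? ? _ -> _ ->.
- by move=> ? ? ? ? _ -> _ ->.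
- by move=> ? ? ?; rewrite addrA.
- by move=> ? ?; rewrite addrC.
- by move=> ?; rewrite add0r.
- by move=> ?; rewrite addNr.
- by move=> ? ? ?; rewrite mulrA.
- by move=> ?; rewrite mul1r.
- by move=> ?; rewrite mulr1.
- by move=> ? ? ?; rewrite mulrDl.
- by move=> ? ? ?; rewrite mulrDr.
Qed.

Definition prlift (x : presented_ring) : A := reval (repr x).

Lemma prlift_cls a : prlift (prcls a) = reval a.
Proof. exact/reval_cong/repr_prcls. Qed.

Lemma presented_ring_lift :
  exists h : {rmorphism presented_ring -> A}, forall g, h (prgen g) = f g.
Proof.
have addP : zmod_morphism prlift.
  elim/prcls_surj=> a; elim/prcls_surj=> b.
  by rewrite -prclsN -prclsD !prlift_cls.
have mulP : monoid_morphism prlift.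
  split; first by rewrite -prcls1 prlift_cls.
  by elim/prcls_surj=> a; elim/prcls_surj=> b; rewrite -prclsM !prlift_cls.
pose aM := GRing.isZmodMorphism.Build _ _ prlift addP.
pose mM := GRing.isMonoidMorphism.Build _ _ prlift mulP.
pose h : {rmorphism presented_ring -> A} := HB.pack prlift aM mM.
by exists h => g; apply: prlift_cls.
Qed.

End UniversalProperty.

Lemma presented_ring_ext (A : pzRingType)
    (h h' : {rmorphism presented_ring -> A}) :
  (forall g, h (prgen g) = h' (prgen g)) -> h =1 h'.
Proof.
move=> hE; elim/prcls_surj; elim=> [g|||a IH|a IHa b IHb|a IHa b IHb].
- exact: hE.
- by rewrite prcls0 !rmorph0.
- by rewrite prcls1 !rmorph1.
- by rewrite prclsN !rmorphN IH.
- by rewrite prclsD !rmorphD IHa IHb.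
- by rewrite prclsM !rmorphM IHa IHb.
Qed.

End PresentedRing.

Variant rack_gen (X : Type) : Type :=
| GEta of X & X
| GEtaV of X & X
| GTau of X & X.

Section RackAlgebra.
Variable X : rackType.
Implicit Types i j k : X.

Local Notation "a *t b" := (RMul a b) (at level 40).
Local Notation "a +t b" := (RAdd a b) (at level 50).
Local Notation eta_ i j := (RGen (GEta i j)).
Local Notation etaV_ i j := (RGen (GEtaV i j)).
Local Notation tau_ i j := (RGen (GTau i j)).

Variant rack_rel : rterm (rack_gen X) -> rterm (rack_gen X) -> Prop :=
| rack_rel_etaV i j : rack_rel (eta_ i j *t etaV_ i j) ROne
| rack_rel_Veta i j : rack_rel (etaV_ i j *t eta_ i j) ROne
| rack_rel_eta i j k :
    rack_rel (eta_ i (j ▷ k) *t eta_ j k) (eta_ (i ▷ j) (i ▷ k) *t eta_ i k)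
| rack_rel_tau i j k :
    rack_rel (tau_ i (j ▷ k))
      (eta_ (i ▷ j) (i ▷ k) *t tau_ i k +t tau_ (i ▷ j) (i ▷ k) *t tau_ i j)
| rack_rel_etatau i j k :
    rack_rel (eta_ i (j ▷ k) *t tau_ j k) (tau_ (i ▷ j) (i ▷ k) *t eta_ i j).

Definition rack_alg := presented_ring rack_rel.

HB.instance Definition _ := GRing.PzRing.on rack_alg.

Definition rack_eta i j : rack_alg := prgen rack_rel (GEta i j).
Definition rack_etaV i j : rack_alg := prgen rack_rel (GEtaV i j).
Definition rack_tau i j : rack_alg := prgen rack_rel (GTau i j).

(* eta |-> 1, tau |-> 0 is a ring morphism to the integers, hence 1 != 0 *)
Fact rack_alg_oner_neq0 : 1 != 0 :> rack_alg.
Proof.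
pose f (g : rack_gen X) : int := if g is GTau _ _ then 0 else 1.
have f_rel a b : rack_rel a b -> reval f a = reval f b by case.
have [h _] := presented_ring_lift f_rel.
apply/eqP=> /(congr1 h); rewrite rmorph1 rmorph0; exact/eqP/oner_neq0.
Qed.

HB.instance Definition _ :=
  GRing.PzSemiRing_isNonZero.Build rack_alg rack_alg_oner_neq0.

Lemma eta_etaV i j : rack_eta i j * rack_etaV i j = 1.
Proof. by rewrite -prclsM -prcls1; apply/prclsP/rcong_rel/rack_rel_etaV. Qed.

Lemma etaV_eta i j : rack_etaV i j * rack_eta i j = 1.
Proof. by rewrite -prclsM -prcls1; apply/prclsP/rcong_rel/rack_rel_Veta. Qed.

Lemma eta_op i j k :
  rack_eta i (j ▷ k) * rack_eta j k = rack_eta (i ▷ j) (i ▷ k) * rack_eta i k.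
Proof. by rewrite -!prclsM; apply/prclsP/rcong_rel/rack_rel_eta. Qed.

Lemma tau_op i j k :
  rack_tau i (j ▷ k) =
    rack_eta (i ▷ j) (i ▷ k) * rack_tau i k
    + rack_tau (i ▷ j) (i ▷ k) * rack_tau i j.
Proof. by rewrite -!prclsM -prclsD; apply/prclsP/rcong_rel/rack_rel_tau. Qed.

Lemma eta_tau i j k :
  rack_eta i (j ▷ k) * rack_tau j k = rack_tau (i ▷ j) (i ▷ k) * rack_eta i j.
Proof. by rewrite -!prclsM; apply/prclsP/rcong_rel/rack_rel_etatau. Qed.

End RackAlgebra.

Section FreeLift.
Variables (R : nzRingType) (K : choiceType) (M : lmodType R) (f : K -> M).

HB.instance Definition _ :=
  GRing.isZmodMorphism.Build _ _ (fglift f) (lift_is_additive f).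

Fact fglift_scalable : scalable (fglift f).
Proof.
move=> c D; rewrite -[D in RHS]freeg_sumE [c *: D]/(fgscale c D) !raddf_sum /=.
by apply: eq_bigr => x _; rewrite !liftU scalerA.
Qed.

HB.instance Definition _ :=
  GRing.isScalable.Build R {freeg K / R} M *:%R (fglift f) fglift_scalable.

End FreeLift.

Section RackComplex.
Variable X : rackType.

Definition chains (n : nat) := {freeg (n.-tuple X) / rack_alg X}.

HB.instance Definition _ n := GRing.Lmodule.on (chains n).

Definition cell n (x : n.-tuple X) : chains n := << x >>.

(* With 0-based indices, (x_0, ..., ^x_i, ..., x_n) *)
Definition omit n (x : n.+1.-tuple X) (i : 'I_n.+1) : n.-tuple X :=
  [tuple tnth x (fintype.lift i j) | j < n].

(* With 0-based indices, (x_0, ..., x_(i-1), x_i ▷ x_(i+1), ..., x_i ▷ x_n) *)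
Definition omit_act n (x : n.+1.-tuple X) (i : 'I_n.+1) : n.-tuple X :=
  [tuple if (j < i)%N then tnth x (fintype.lift i j)
         else tnth x i ▷ tnth x (fintype.lift i j) | j < n].

Variable pt : X.

(* The index i : 'I_m.+1 stands for the 1-based index i.+1 of the usual formula,
   whence the sign (-1) ^+ i.+1 and the prefix [x_1 ... x_(i+1)] as the bracket
   of take i.+1 x. All bracketed sequences are nonempty, so that the default
   value pt of bracket is never used. *)
Definition boundary_cell (n : nat) : n.+1.-tuple X -> chains n :=
  match n return n.+1.-tuple X -> chains n with
  | 0 => fun x => - (rack_tau pt (rack_inv pt (thead x)) *: cell [tuple])
  | m.+1 => fun x =>
      let widen (i : 'I_m.+1) : 'I_m.+2 := widen_ord (leqnSn m.+1) i in
      \sum_(i < m.+1)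
         ((-1) ^+ i.+1 *
          rack_eta (bracket pt (take i.+1 x)) (bracket pt (omit x (widen i))))
            *: cell (omit x (widen i))
      - \sum_(i < m.+1) (-1) ^+ i.+1 *: cell (omit_act x (widen i))
      - ((-1) ^+ m.+2 *
         rack_tau (bracket pt (omit x ord_max))
                  (bracket pt (omit x (widen ord_max))))
            *: cell (omit x ord_max)
  end.

Definition boundary (n : nat) : {linear chains n.+1 -> chains n} :=
  fglift (@boundary_cell n).

Lemma boundaryE n (x : n.+1.-tuple X) : boundary n (cell x) = boundary_cell x.
Proof. by rewrite /= /cell liftU scale1r. Qed.

End RackComplex.

Arguments chains : clear implicits.

(* Main.v *)
Require Import Defs.
From HB Require Import structures.
From mathcomp Require Import all_boot all_algebra.
From mathcomp.multinomials Require Import freeg.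

Set Implicit Arguments.
Unset Strict Implicit.
Unset Printing Implicit Defensive.

Import GRing.Theory.
Local Open Scope ring_scope.

(** The complex is a cubical one with an extra last face.  For
    [s = (x_1, ..., x_(n+1))] and [i <= n] consider the two faces
    [d0_i s = eta_(a, b) . omit_i s], where [a = [x_1 ... x_i]] and
    [b = [x_1 ... ^x_i ... x_(n+1)]], and [d1_i s = act_i s], which omits [x_i]
    and lets it act on all later entries; let [T] be the last face, weighted by
    [tau].  Everything rests on two identities for brackets:

    - [[x_1 ... x_i] ▷ [x_1 ... ^x_i ... x_k] = [x_1 ... x_k]] for [i < k]
      (bracket_omit_at), which turns the weights into instances of the left and
      right hand sides of the defining relations of the rack algebra;
    - the bracket is invariant under [d1_i] (bracket_act_at), so that [d1_i]
      does not disturb the weights of the other faces.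

    With [f_i = d0_i - d1_i] the first relation of the rack algebra gives the
    cubical identities [f_i f_j = f_(j-1) f_i] for [i < j] (face_face), the third
    one gives [T f_i = f_i T] for [i < n] (last_face_face), and the second one
    gives [T f_n + T T = 0] for the last index [n] (face_last_face).  The boundary
    being [sum_i (-1)^i f_i - (-1)^(n+1) T], in its square the terms without [T]
    cancel in pairs (alternating_square_sum), those with one [T] cancel except
    for [T f_n], and this one cancels against [T T].

    The identity [i ▷ j = [x_1 ... x_(n+1)]] for the indices of the [tau] weight
    allows writing that weight as [tau_(i, i^-1 ▷ [x_1 ... x_(n+1)])] with
    [i = [x_1 ... x_n]].  If the empty bracket is read as the base point, this is
    also the weight in the special formula for [n = 0], up to sign; hence the
    lowest degree needs no separate argument, apart from this sign.

    The computations are done on sequences and dually to chains: faces act on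
    functions [g] from sequences to a module, by linear evaluation of [g] at the
    face.  This makes the order of composition the reverse of the usual one. *)

(** * Omitting an entry of a sequence *)

Section SequenceFaces.
Variable X : rackType.
Implicit Types (x : X) (s : seq X) (i j : nat).

Fixpoint omit_at i s {struct s} : seq X :=
  match s, i with
  | [::], _ => [::]
  | _ :: s', 0 => s'
  | x :: s', i'.+1 => x :: omit_at i' s'
  end.

Fixpoint act_at i s {struct s} : seq X :=
  match s, i with
  | [::], _ => [::]
  | x :: s', 0 => map (rack_op x) s'
  | x :: s', i'.+1 => x :: act_at i' s'
  end.

Lemma size_omit_at i s : (i < size s)%N -> size (omit_at i s) = (size s).-1.
Proof.
elim: s i => [|x s IH] [|i] //=; rewrite ltnS => lt_is.
by rewrite IH // prednK // (leq_ltn_trans _ lt_is).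
Qed.

Lemma size_act_at i s : (i < size s)%N -> size (act_at i s) = (size s).-1.
Proof.
elim: s i => [|x s IH] [|i] //=; rewrite ?size_map // ltnS => lt_is.
by rewrite IH // prednK // (leq_ltn_trans _ lt_is).
Qed.

Lemma nth_omit_at d i s j : nth d (omit_at i s) j = nth d s (bump i j).
Proof.
elim: s i j => [|x s IH] [|i] [|j] //=; rewrite ?nth_nil //.
by rewrite IH /bump ltnS addnS.
Qed.

Lemma nth_act_at d i s j : (j.+1 < size s)%N ->
  nth d (act_at i s) j =
    if (j < i)%N then nth d s j else nth d s i ▷ nth d s j.+1.
Proof.
elim: s i j => [|x s IH] [|i] [|j] //=; rewrite ?ltnS => lt_js.
- by rewrite (nth_map d).
- by rewrite (nth_map d).
- by rewrite IH.
Qed.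

Lemma map_omit_at x i s :
  map (rack_op x) (omit_at i s) = omit_at i (map (rack_op x) s).
Proof. by elim: s i => [|y s IH] [|i] //=; rewrite IH. Qed.

Lemma map_act_at x i s :
  map (rack_op x) (act_at i s) = act_at i (map (rack_op x) s).
Proof.
elim: s i => [|y s IH] [|i] //=; last by rewrite IH.
by rewrite -!map_comp; apply: eq_map => z /=; rewrite rack_opD.
Qed.

Lemma omit_at_omit_at i j s : (i <= j)%N ->
  omit_at i (omit_at j.+1 s) = omit_at j (omit_at i s).
Proof. by elim: s i j => [|x s IH] [|i] [|j] //= le_ij; rewrite IH. Qed.

Lemma act_at_omit_at i j s : (i <= j)%N ->
  act_at i (omit_at j.+1 s) = omit_at j (act_at i s).
Proof.
elim: s i j => [|x s IH] [|i] j //= le_ij; first by rewrite map_omit_at.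
by case: j le_ij => // j le_ij; rewrite IH.
Qed.

Lemma omit_at_act_at i j s : (i <= j)%N ->
  omit_at i (act_at j.+1 s) = act_at j (omit_at i s).
Proof. by elim: s i j => [|x s IH] [|i] [|j] //= le_ij; rewrite IH. Qed.

Lemma act_at_act_at i j s : (i <= j)%N ->
  act_at i (act_at j.+1 s) = act_at j (act_at i s).
Proof.
elim: s i j => [|x s IH] [|i] j //= le_ij; first by rewrite map_act_at.
by case: j le_ij => // j le_ij; rewrite IH.
Qed.

Lemma take_omit_at_le i j s : (i <= j)%N ->
  take j (omit_at i s) = omit_at i (take j.+1 s).
Proof. by elim: s i j => [|x s IH] [|i] [|j] //= le_ij; rewrite IH. Qed.

Lemma take_act_at_le i j s : (i <= j)%N ->
  take j (act_at i s) = act_at i (take j.+1 s).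
Proof.
elim: s i j => [|x s IH] [|i] j //= le_ij; first by rewrite map_take.
by case: j le_ij => // j le_ij; rewrite /= IH.
Qed.

Lemma take_omit_at_ge i j s : (i <= j)%N -> take i (omit_at j s) = take i s.
Proof. by elim: s i j => [|x s IH] [|i] [|j] //= le_ij; rewrite ?take0 ?IH. Qed.

Lemma take_act_at_ge i j s : (i <= j)%N -> take i (act_at j s) = take i s.
Proof. by elim: s i j => [|x s IH] [|i] [|j] //= le_ij; rewrite ?take0 ?IH. Qed.

Lemma omit_at_last i s : size s = i.+1 -> omit_at i s = take i s.
Proof.
elim: s i => [|x s IH] [|i] //= [sz_s]; last by rewrite IH.
exact: size0nil.
Qed.

End SequenceFaces.

(** * Brackets *)

Section Brackets.
Variables (X : rackType) (d : X).
Implicit Types (x : X) (s : seq X) (i : nat).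

Lemma bracket_cons x s : (0 < size s)%N ->
  bracket d (x :: s) = x ▷ bracket d s.
Proof. by case: s. Qed.

Lemma bracket_map x s : (0 < size s)%N ->
  bracket d (map (rack_op x) s) = x ▷ bracket d s.
Proof.
elim: s => // y [|z s] IH _ //.
by rewrite map_cons bracket_cons // IH // -rack_opD.
Qed.

(** By self-distributivity, acting by the common prefix [x_1, ..., x_(i-1)] is
    an automorphism of the rack; it reduces the claim to the definition of the
    bracket of [x_i, ..., x_k]. *)
Lemma bracket_omit_at i s : (i.+1 < size s)%N ->
  bracket d (take i.+1 s) ▷ bracket d (omit_at i s) = bracket d s.
Proof.
elim: s i => // x s IH [|i]; rewrite [size _]/= ltnS => lt_is.
  by rewrite bracket_cons // take_cons take0.
have s_gt1 : (1 < size s)%N by apply: leq_ltn_trans lt_is.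
rewrite [omit_at _ _]/= take_cons !bracket_cons.
- by rewrite -rack_opD IH.
- exact: ltnW.
- by rewrite size_omit_at -?subn1 ?subn_gt0 // ltnW.
- by rewrite size_takel // ltnW.
Qed.

(** The last entry is excluded: there is nothing on which it could act. *)
Lemma bracket_act_at i s : (i.+1 < size s)%N ->
  bracket d (act_at i s) = bracket d s.
Proof.
elim: s i => // x s IH [|i]; rewrite [size _]/= ltnS => lt_is.
  by rewrite bracket_map // bracket_cons.
have s_gt1 : (1 < size s)%N by apply: leq_ltn_trans lt_is.
rewrite [act_at _ _]/= !bracket_cons ?IH //; first exact: ltnW.
by rewrite size_act_at -?subn1 ?subn_gt0 // ltnW.
Qed.

End Brackets.

(** * Faces and their commutation relations *)

Section Faces.
Variables (X : rackType) (pt : X) (M : lmodType (rack_alg X)).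
Implicit Types (s : seq X) (g : seq X -> M) (i j n : nat).

Definition eta_weight i s : rack_alg X :=
  rack_eta (bracket pt (take i.+1 s)) (bracket pt (omit_at i s)).

(** For [0 < n] the second index is [[x_1 ... x_(n-1) x_(n+1)]]; the present
    form also makes sense for [n = 0], where the empty bracket is [pt]. *)
Definition tau_weight n s : rack_alg X :=
  rack_tau (bracket pt (take n s))
           (rack_inv (bracket pt (take n s)) (bracket pt s)).

Definition face i g s : M :=
  eta_weight i s *: g (omit_at i s) - g (act_at i s).

Definition last_face n g s : M := tau_weight n s *: g (take n s).

Lemma tau_weightE n s : size s = n.+2 ->
  tau_weight n.+1 s =
    rack_tau (bracket pt (take n.+1 s)) (bracket pt (omit_at n s)).
Proof.
move=> sz_s; rewrite /tau_weight -(bracket_omit_at pt (i := n) (s := s)) ?sz_s //.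
by rewrite rack_opK.
Qed.

Lemma eta_weight_omit_at i j s : (i <= j)%N -> (j.+2 < size s)%N ->
  eta_weight j.+1 s * eta_weight i (omit_at j.+1 s) =
    eta_weight i s * eta_weight j (omit_at i s).
Proof.
move=> le_ij lt_js; have le_ij1 := leqW le_ij; rewrite /eta_weight.
have lt_is : (i.+1 < size s)%N by rewrite (leq_ltn_trans _ (ltnW lt_js)).
rewrite take_omit_at_ge // take_omit_at_le // omit_at_omit_at //.
rewrite -(@bracket_omit_at _ pt i (take j.+2 s)); last first.
  by rewrite size_takel // ltnW.
rewrite -(@bracket_omit_at _ pt i (omit_at j.+1 s)); last first.
  rewrite size_omit_at; last exact: ltnW.
  by case: (size s) lt_js => //= k; rewrite ltnS; apply: leq_ltn_trans.
rewrite take_takel // take_omit_at_ge // omit_at_omit_at // -eta_op.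
congr (rack_eta _ _ * _).
rewrite -take_omit_at_le // bracket_omit_at // size_omit_at; last exact: ltnW.
by case: (size s) lt_js.
Qed.

Lemma eta_weight_act_at_lt i j s : (i <= j)%N -> (j.+2 < size s)%N ->
  eta_weight j (act_at i s) = eta_weight j.+1 s.
Proof.
move=> le_ij lt_js; have le_ij1 := leqW le_ij.
rewrite /eta_weight take_act_at_le // -act_at_omit_at //.
rewrite !bracket_act_at // ?size_takel ?size_omit_at //; try exact: ltnW.
by case: (size s) lt_js => //= k; rewrite ltnS; apply: leq_ltn_trans.
Qed.

Lemma eta_weight_act_at_gt i j s : (i <= j)%N -> (j.+2 < size s)%N ->
  eta_weight i (act_at j.+1 s) = eta_weight i s.
Proof.
move=> le_ij lt_js; rewrite /eta_weight take_act_at_ge // omit_at_act_at //.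
have lt_is : (i < size s)%N.
  by rewrite (leq_ltn_trans le_ij) // ltnW // ltnW.
rewrite [bracket _ (act_at _ _)]bracket_act_at // size_omit_at //.
by case: (size s) lt_js.
Qed.

Lemma face_face g i j s : (i <= j)%N -> (j.+2 < size s)%N ->
  face j.+1 (face i g) s = face i (face j g) s.
Proof.
move=> le_ij lt_js; rewrite /face !scalerBr !scalerA eta_weight_omit_at //.
rewrite omit_at_omit_at // act_at_omit_at // omit_at_act_at // act_at_act_at //.
rewrite (@eta_weight_act_at_lt i j) // eta_weight_act_at_gt // !opprB.
by rewrite addrACA [RHS]addrACA; congr (_ + _); rewrite addrC.
Qed.

Lemma last_face_face g i n s : (i < n)%N -> size s = n.+2 ->
  last_face n.+1 (face i g) s = face i (last_face n g) s.
Proof.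
case: n => // n; rewrite ltnS => le_in sz_s; rewrite /last_face /face.
have lt_is : (i < size s)%N by rewrite sz_s ltnW // ltnS leqW // leqW.
have lt_is1 : (i.+1 < size s)%N by rewrite sz_s !ltnS leqW.
have sz_o : size (omit_at i s) = n.+2 by rewrite size_omit_at // sz_s.
rewrite scalerBr !scalerA take_omit_at_le 1?leqW // take_act_at_le 1?leqW //.
have -> : tau_weight n.+1 (act_at i s) = tau_weight n.+2 s.
  rewrite /tau_weight take_act_at_le 1?leqW // !bracket_act_at //.
  by rewrite size_takel ?sz_s.
congr (_ *: _ - _); rewrite !tau_weightE // /eta_weight.
rewrite take_takel; last by rewrite ltnS leqW.
rewrite -(@bracket_omit_at _ pt i (take n.+2 s)); last first.
  by rewrite size_takel ?sz_s.
rewrite -(@bracket_omit_at _ pt i (omit_at n.+1 s)); last first.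
  by rewrite size_omit_at sz_s.
rewrite take_takel; last by rewrite ltnS leqW.
rewrite take_omit_at_ge // omit_at_omit_at // -eta_tau.
congr (rack_eta _ _ * rack_tau _ _).
  by rewrite -take_omit_at_le 1?leqW // bracket_omit_at // sz_o.
by rewrite take_omit_at_le // leqW.
Qed.

(** With [a = [x_1 ... x_n]], which is [pt] for [n = 0], and [j], [k] such that
    [a ▷ j = [x_1 ... x_(n+1)]] and [a ▷ k = [x_1 ... x_n x_(n+2)]], this is the
    relation expressing [tau_(a, j ▷ k)]. *)
Lemma face_last_face g n s : size s = n.+2 ->
  face n (last_face n g) s + last_face n.+1 (last_face n g) s = 0.
Proof.
move=> sz_s; rewrite /face /last_face !scalerA take_takel //.
rewrite take_omit_at_ge // take_act_at_ge //.
rewrite addrAC -scalerDl -scalerBl; apply/eqP.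
rewrite (_ : _ - _ = 0) ?scale0r //; apply/eqP; rewrite subr_eq0; apply/eqP.
rewrite tau_weightE // /eta_weight /tau_weight.
rewrite take_omit_at_ge // take_act_at_ge // take_takel //.
rewrite bracket_act_at ?sz_s //.
set a := bracket pt (take n s).
rewrite -(bracket_omit_at pt (i := n) (s := s)) ?sz_s //.
move: (bracket pt (take n.+1 s)) (bracket pt (omit_at n s)) => p q.
have [j <-] : exists j : X, a ▷ j = p by exists (rack_inv a p); rewrite rack_invK.
have [k <-] : exists k, a ▷ k = q by exists (rack_inv a q); rewrite rack_invK.
by rewrite -rack_opD !rack_opK -tau_op.
Qed.

(** * The square of the boundary *)

(** The value on [s], of size [n.+1], of the boundary followed by the linear
    extension of [g]. *)
Definition bd n g s : M :=
  \sum_(i < n) (-1) ^+ i.+1 *: face i g s - (-1) ^+ n.+1 *: last_face n g s.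

Lemma faceB i g h s :
  face i (fun s' => g s' - h s') s = face i g s - face i h s.
Proof.
rewrite /face scalerBr !opprB addrACA [RHS]addrACA.
by congr (_ + _); rewrite addrC.
Qed.

Lemma face_sign i k g s :
  face i (fun s' => (-1) ^+ k *: g s') s = (-1) ^+ k *: face i g s.
Proof. by rewrite /face scalerBr !scalerA commr_sign. Qed.

Lemma face_sum i n (G : 'I_n -> seq X -> M) s :
  face i (fun s' => \sum_k G k s') s = \sum_k face i (G k) s.
Proof. by rewrite /face scaler_sumr sumrB. Qed.

Lemma face_bd i n g s : face i (bd n g) s =
  \sum_(k < n) (-1) ^+ k.+1 *: face i (face k g) s
  - (-1) ^+ n.+1 *: face i (last_face n g) s.
Proof.
rewrite /bd faceB face_sum face_sign; congr (_ - _).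
by apply: eq_bigr => k _; rewrite face_sign.
Qed.

Lemma last_face_bd m n g s : last_face m (bd n g) s =
  \sum_(k < n) (-1) ^+ k.+1 *: last_face m (face k g) s
  - (-1) ^+ n.+1 *: last_face m (last_face n g) s.
Proof.
rewrite {1}/last_face /bd scalerBr scaler_sumr; congr (_ - _).
  by apply: eq_bigr => k _; rewrite scalerA commr_sign -scalerA.
by rewrite scalerA commr_sign -scalerA.
Qed.

(** For [i <= j] the terms of [F j.+1 i] and [F i j] have opposite signs, and
    these pairs exhaust the rectangle of indices. *)
Lemma alternating_square_sum n (F : nat -> nat -> M) :
    (forall i j, (i <= j < n)%N -> F j.+1 i = F i j) ->
  \sum_(j < n.+1) \sum_(i < n) (-1) ^+ (j + i) *: F j i = 0.
Proof.
elim: n => [|n IH] F_swap; first by apply: big1 => j _; rewrite big_ord0.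
rewrite big_ord_recr; under eq_bigr do rewrite big_ord_recr.
rewrite big_split IH /=; last first.
  by move=> i j /andP[le_ij lt_jn]; rewrite F_swap // le_ij leqW.
rewrite add0r -big_split; apply: big1 => i _ /=.
rewrite F_swap; last by rewrite -ltnS ltn_ord ltnSn.
by rewrite addSn exprS mulN1r scaleNr addnC subrr.
Qed.

Lemma bd_bd n g s : size s = n.+2 -> bd n.+1 (bd n g) s = 0.
Proof.
move=> sz_s; pose L i := face i (last_face n g) s.
have signM a b : (-1) ^+ a.+1 * (-1) ^+ b.+1 = (-1) ^+ (a + b) :> rack_alg X.
  by rewrite !exprS !mulN1r mulrNN exprD.
have signMS a b : (-1) ^+ a.+2 * (-1) ^+ b.+1 = - (-1) ^+ (b + a) :> rack_alg X.
  by rewrite signM addSn exprS mulN1r addnC.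
have signnn : (-1) ^+ (n + n) = 1 :> rack_alg X.
  by rewrite -signr_odd addnn odd_double.
have faces_bd : \sum_(j < n.+1) (-1) ^+ j.+1 *: face j (bd n g) s =
    - \sum_(j < n.+1) (-1) ^+ (j + n) *: L j.
  pose F j i := face j (face i g) s.
  have square0 : \sum_(j < n.+1) \sum_(i < n) (-1) ^+ (j + i) *: F j i = 0.
    apply: alternating_square_sum => i j /andP[le_ij lt_jn].
    by rewrite /F face_face // sz_s !ltnS.
  rewrite -[RHS]add0r -[X in X - _]square0.
  rewrite -sumrB; apply: eq_bigr => j _.
  rewrite face_bd scalerBr scaler_sumr scalerA signM; congr (_ - _).
  by apply: eq_bigr => i _; rewrite scalerA signM.
have last_bd : (-1) ^+ n.+2 *: last_face n.+1 (bd n g) s =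
    last_face n.+1 (last_face n g) s - \sum_(i < n) (-1) ^+ (i + n) *: L i.
  rewrite last_face_bd scalerBr scaler_sumr scalerA signMS.
  rewrite scaleNr opprK signnn scale1r addrC; congr (_ + _).
  rewrite -sumrN; apply: eq_bigr => i _.
  by rewrite scalerA signMS scaleNr last_face_face.
rewrite {1}/bd faces_bd last_bd big_ord_recr /= signnn scale1r opprB opprD.
by rewrite addrACA addNr add0r -opprD face_last_face ?oppr0.
Qed.

Lemma eq_bd n g h s : size s = n.+1 ->
    (forall s', size s' = n -> g s' = h s') ->
  bd n g s = bd n h s.
Proof.
move=> sz_s eq_gh; rewrite /bd /last_face /face; congr (_ - _).
  apply: eq_bigr => i _.
  have lt_is : (i < size s)%N by rewrite sz_s ltnW // ltnS.
  by rewrite !eq_gh // ?size_omit_at ?size_act_at // sz_s.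
by rewrite eq_gh // size_takel ?sz_s.
Qed.

End Faces.

(** For [f] a boundary map and [g] the inclusion of the basis, this turns the
    composition of boundary maps into an iteration of [bd]. *)
Lemma linear_bd (X : rackType) (pt : X) (M N : lmodType (rack_alg X))
    (f : {linear M -> N}) n g s :
  f (bd pt n g s) = bd pt n (f \o g) s.
Proof.
have fZ a u : f (a *: u) = a *: f u by rewrite linearZ_LR.
have fB u v : f (u - v) = f u - f v by rewrite raddfB.
rewrite /bd /last_face fB !fZ raddf_sum /=; congr (_ - _).
by apply: eq_bigr => i _; rewrite /face fZ fB fZ.
Qed.

(** * Comparison with chains on tuples *)

Section Comparison.
Variables (X : rackType) (pt : X).

Lemma val_omit n (x : n.+1.-tuple X) i : omit x i = omit_at i x :> seq X.
Proof.
have sz : size (omit_at i x) = n by rewrite size_omit_at size_tuple.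
apply: (@eq_from_nth _ pt); first by rewrite sz size_tuple.
rewrite size_tuple => j lt_jn; rewrite nth_omit_at.
by rewrite -(tnth_nth _ _ (Ordinal lt_jn)) tnth_mktuple (tnth_nth pt).
Qed.

Lemma val_omit_act n (x : n.+1.-tuple X) i : omit_act x i = act_at i x :> seq X.
Proof.
have sz : size (act_at i x) = n by rewrite size_act_at size_tuple.
apply: (@eq_from_nth _ pt); first by rewrite sz size_tuple.
rewrite size_tuple => j lt_jn; rewrite nth_act_at ?size_tuple //.
rewrite -(tnth_nth _ _ (Ordinal lt_jn)) tnth_mktuple !(tnth_nth pt) /=.
by rewrite /bump [(i <= j)%N]leqNgt; case: (j < i)%N.
Qed.

(** The inclusion of the basis, extended by a default value to sequences of the
    wrong size, because [bd] takes functions on all sequences. *)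
Definition seq_cell n (s : seq X) : chains X n :=
  cell (insubd [tuple of nseq n pt] s).

Lemma seq_cellE n (x : n.-tuple X) : seq_cell n x = cell x.
Proof.
rewrite /seq_cell; congr cell; apply: val_inj.
by rewrite val_insubd size_tuple eqxx.
Qed.

Lemma boundary_cell_bd n (x : n.+2.-tuple X) :
  boundary_cell pt x = bd pt n.+1 (seq_cell n.+1) x.
Proof.
rewrite /boundary_cell /bd -sumrB; congr (_ - _).
  apply: eq_bigr => i _; rewrite /face /eta_weight scalerBr scalerA.
  by rewrite -!seq_cellE !val_omit val_omit_act.
have take_omit : take n.+1 x = omit x ord_max.
  by rewrite val_omit omit_at_last // size_tuple.
rewrite /last_face tau_weightE ?size_tuple // scalerA.
by rewrite take_omit seq_cellE !val_omit.
Qed.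

(** In degree [0] the general formula would have the opposite sign. *)
Lemma boundary_cell0_bd (x : 1.-tuple X) :
  boundary_cell pt x = - bd pt 0 (seq_cell 0) x.
Proof.
rewrite /bd big_ord0 sub0r opprK expr1 scaleN1r /last_face /tau_weight take0.
case/tupleP: x => x t; rewrite (tuple0 t) /= theadE.
by rewrite -(seq_cellE [tuple]).
Qed.

Lemma boundary_boundary_cell n (x : n.+2.-tuple X) :
  boundary pt n (boundary pt n.+1 (cell x)) = 0.
Proof.
rewrite boundaryE boundary_cell_bd linear_bd.
have sz_x : size x = n.+2 by rewrite size_tuple.
case: n x sz_x => [|n] x sz_x.
  rewrite (@eq_bd _ _ _ _ _ (-%R \o bd pt 0 (seq_cell 0))) //.
    by rewrite -(linear_bd pt (@GRing.opp _)) bd_bd // /= oppr0.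
  move=> s sz_s; pose t : 1.-tuple X := tcast sz_s (in_tuple s).
  have -> : s = t by rewrite val_tcast.
  by rewrite /= seq_cellE boundaryE boundary_cell0_bd.
rewrite (@eq_bd _ _ _ _ _ (bd pt n.+1 (seq_cell n.+1))) ?bd_bd //.
move=> s sz_s; pose t : n.+2.-tuple X := tcast sz_s (in_tuple s).
have -> : s = t by rewrite val_tcast.
by rewrite /= seq_cellE boundaryE boundary_cell_bd.
Qed.

End Comparison.

Theorem lemma4p2 (X : rackType) (pt : X) (n : nat) (c : chains X n.+2) :
  boundary pt n (boundary pt n.+1 c) = 0.
Proof.
rewrite -[c]freeg_sumE !raddf_sum big1 // => x _ /=.
have -> : << coeff x c *g x >> = coeff x c *: cell x :> chains X n.+2.
  by apply/eqP/freeg_eqP=> y; rewrite coeffZ !coeffU mul1r.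
have dZ m a u : boundary pt m (a *: u) = a *: boundary pt m u.
  by rewrite linearZ_LR.
by rewrite dZ dZ boundary_boundary_cell scaler0.
Qed.
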